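(* Let $V$ be a finite set (case $q=1$) or a finite-dimensional $\mathbb{F}_q$-vector space (case $q\ge 2$ a prime power) with $n=\operatorname{rk}V\ge1$. Let $P\in{V\brack 1}$ be a point and $1\le k\le n$. Then $$\Phi:\mathbb{R}^{{V/P\brack k-1}}\to\mathbb{R}^{{V\brack k}},\qquad \Phi(f):K\mapsto\begin{cases}f(K/P)&\text{if }P\le K,\\0&\text{if }P\nleq K\end{cases}$$ is an injective $\mathbb{R}$-linear map with image $$\operatorname{im}(\Phi)=\Big\{g\in\mathbb{R}^{{V\brack k}}\ \Big|\ \operatorname{supp}g\subseteq\{K\in{V\brack k}\mid P\le K\}\Big\},$$ and for all $f:{V/P\brack k-1}\to\mathbb{R}$ $$\deg_V(\Phi(f))=\min(\deg_{V/P}(f)+1,\;n-k).$$ Moreover, for all $e\in\{\max(\deg_{V/P}(f),0)+1,\ldots,\min(k,n-k)\}$ and $E\in{V\brack e}$, $$\operatorname{wt}^{(e)}_{\Phi(f)}(E)=\begin{cases}\operatorname{wt}^{(e-1)}_f(E/P)&\text{if }P\le E,\\0&\text{if }P\nleq E.\end{cases}$$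
   Context: For $q=1$, ''subspaces'' of $V$ are subsets, $\operatorname{rk}U=\#U$, and $U/P$ means $U\setminus P$ for $P\subseteq U$; for $q\ge2$ they are $\mathbb{F}_q$-linear subspaces, $\operatorname{rk}U=\dim U$, and $U/P$ is the quotient space. $U\le W$ means inclusion. For any ambient space $W$ of rank $m$ (here $W=V$ with $m=n$, or $W=V/P$ with $m=n-1$), ${W\brack k}$ is the set of all subspaces of $W$ of rank $k$. For a subspace $U$ of $W$, $\boldsymbol{x}_U^{(k)}:{W\brack k}\to\mathbb{R}$ is the characteristic function of $\{K\in{W\brack k}\mid U\le K\}$. For $0\le k\le m$ and $i\in\{0,\ldots,\min(k,m-k)\}$, let $\bar V_i^{(k)}(W)\subseteq\mathbb{R}^{{W\brack k}}$ be the real span of $\{\boldsymbol{x}_I^{(k)}\mid I\in{W\brack i}\}$; this set is a basis of $\bar V_i^{(k)}(W)$ (a known fact), and these spaces form an increasing chain ending in $\mathbb{R}^{{W\brack k}}$ for $i=\min(k,m-k)$. For $f\in\bar V_i^{(k)}(W)$, the $i$-weight distribution $\operatorname{wt}_f^{(i)}:{W\brack i}\to\mathbb{R}$ is the unique function with $f=\sum_{I\in{W\brack i}}\operatorname{wt}_f^{(i)}(I)\,\boldsymbol{x}_I^{(k)}$. The degree $\deg_W(f)$ of a non-zero $f:{W\brack k}\to\mathbb{R}$ is the smallest $t\in\{0,\ldots,\min(k,m-k)\}$ with $f\in\bar V_t^{(k)}(W)$; $\deg_W(\boldsymbol 0)=-\infty$, with $-\infty+1=-\infty$. *)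

(* Defs.v *)
From HB Require Import structures.
From mathcomp Require Import all_boot all_order all_algebra.
From mathcomp Require Import generic_quotient ring_quotient.
From mathcomp Require Import boolp classical_sets reals constructive_ereal.

Set Implicit Arguments.
Unset Strict Implicit.
Unset Printing Implicit Defensive.

Import Order.TTheory GRing.Theory Num.Theory.
Local Open Scope quotient_scope.
Local Open Scope ring_scope.

Section FinSubspaces.
Import VectorInternalTheory.
Variables (F : finFieldType) (V : vectType F).
HB.instance Definition _ := [Countable of {vspace V} by <:].
HB.instance Definition _ := [Finite of {vspace V} by <:].
End FinSubspaces.

(* The additive group V / U is MathComp's [Quotient.quot]; it is made here into
   a finite-dimensional vector space. *)
Section QuotientSpace.
Variables (F : fieldType) (V : vectType F) (U : {vspace V}).

Definition quotv : Type := @Quotient.quot V (pred_of_vspace U).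

HB.instance Definition _ := Choice.on quotv.
HB.instance Definition _ := GRing.Zmodule.on quotv.

Definition piv (v : V) : quotv := \pi_(@Quotient.quot V (pred_of_vspace U)) v.

Lemma pivD : {morph piv : v w / v + w}.
Proof. by move=> v w; rewrite /piv !piE. Qed.

Lemma piv_surj (x : quotv) : exists v, piv v = x.
Proof. by exists (repr x); exact: reprK. Qed.

Lemma piv_eq (v w : V) : (piv v == piv w) = (v - w \in U).
Proof. by rewrite /piv -Quotient.idealrBE. Qed.

Definition scaleq (a : F) (x : quotv) : quotv :=
  piv (a *: (repr (x : @Quotient.quot V (pred_of_vspace U)))).

Lemma scaleq_piv a v : scaleq a (piv v) = piv (a *: v).
Proof.
apply/eqP; rewrite piv_eq -scalerBr memvZ // -piv_eq.
by apply/eqP; exact: reprK.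
Qed.

Lemma scaleqA a b x : scaleq a (scaleq b x) = scaleq (a * b) x.
Proof. by have [v <-] := piv_surj x; rewrite !scaleq_piv scalerA. Qed.

Lemma scale1q : left_id 1 scaleq.
Proof. by move=> x; have [v <-] := piv_surj x; rewrite scaleq_piv scale1r. Qed.

Lemma scaleqDr : right_distributive scaleq +%R.
Proof.
move=> a x y; have [v <-] := piv_surj x; have [w <-] := piv_surj y.
by rewrite -pivD !scaleq_piv scalerDr pivD.
Qed.

Lemma scaleqDl x : {morph scaleq^~ x : a b / a + b}.
Proof.
by move=> a b; have [v <-] := piv_surj x; rewrite !scaleq_piv scalerDl pivD.
Qed.

HB.instance Definition _ := GRing.Zmodule_isLmodule.Build F quotv
  scaleqA scale1q scaleqDr scaleqDl.

Fact piv_linear : linear piv.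
Proof. by move=> a v w; rewrite pivD -scaleq_piv. Qed.
HB.instance Definition _ := GRing.isLinear.Build F V quotv _ piv piv_linear.

Fact quotv_vect_iso : Vector.axiom (\dim U^C) quotv.
Proof.
pose h (v : V) := v - projv U v.
have hC v : h v \in (U^C)%VS by exact: memv_projC.
have pih v : piv (h v) = piv v.
  by apply/eqP; rewrite piv_eq /h addrAC subrr sub0r rpredN memv_proj.
have hB a v w : h (a *: v + w) = a *: h v + h w.
  by rewrite /h linearP scalerBr opprD addrACA.
have hid c : c \in (U^C)%VS -> h c = c.
  by rewrite -lker_proj memv_ker => /eqP; rewrite /h => ->; rewrite subr0.
have heq v w : piv v = piv w -> h v = h w.
  move/eqP; rewrite piv_eq => vwU; apply/eqP; rewrite -subr_eq0 /h opprD opprK.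
  by rewrite addrACA -{1}(projv_id vwU) linearB addrACA subrr addNr addr0.
pose rp (x : quotv) : V := repr (x : @Quotient.quot V (pred_of_vspace U)).
have rpK x : piv (rp x) = x by exact: reprK.
exists (fun x => \row_i coord (vbasis U^C) i (h (rp x))).
  move=> a x y; apply/rowP=> i; rewrite !mxE -linearP -hB /=.
  by rewrite (heq (rp _) (a *: rp x + rp y)) // linearP /= !rpK.
exists (fun r : 'rV_(\dim U^C) => piv (\sum_i r 0 i *: (vbasis U^C)`_i)).
  move=> x /=; rewrite -[RHS]rpK -[RHS]pih [in RHS](coord_vbasis (hC (rp x))).
  by congr piv; apply: eq_bigr => i _; rewrite mxE.
move=> r; apply/rowP=> i; rewrite mxE.
set s := \sum_j _; have sC : s \in (U^C)%VS.
  by apply: memv_suml => j _; rewrite memvZ // vbasis_mem // mem_nth // size_tuple.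
rewrite (heq _ s) ?rpK // hid // /s.
by rewrite coord_sum_free // (basis_free (vbasisP _)).
Qed.
HB.instance Definition _ := Lmodule_hasFinDim.Build F quotv quotv_vect_iso.

End QuotientSpace.

(* An ambient space: a finite set (the case q = 1) or a finite-dimensional
   vector space over a finite field with q elements. *)
Inductive ambient : Type :=
| SetAmbient (T : finType)
| VectAmbient (F : finFieldType) (V : vectType F).

Definition subspace (W : ambient) : finType :=
  match W with
  | SetAmbient T => {set T}
  | VectAmbient F V => {vspace V}
  end.

Definition rk {W : ambient} : subspace W -> nat :=
  match W with
  | SetAmbient T => fun U : {set T} => #|U|
  | VectAmbient F V => fun U : {vspace V} => \dim U
  end.

Definition subsp {W : ambient} : rel (subspace W) :=
  match W with
  | SetAmbient T => fun U U' : {set T} => U \subset U'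
  | VectAmbient F V => fun U U' : {vspace V} => (U <= U')%VS
  end.

Definition fullsp (W : ambient) : subspace W :=
  match W with
  | SetAmbient T => [set: T]
  | VectAmbient F V => fullv
  end.

Definition quot_ambient (W : ambient) : subspace W -> ambient :=
  match W with
  | SetAmbient T => fun P : {set T} => SetAmbient {x : T | x \notin P}
  | VectAmbient F V => fun P : {vspace V} => VectAmbient (quotv P)
  end.

(* [qsub P U] is U / P as a subspace of V / P, intended for P <= U; for sets it
   is U :\: P, seen inside the complement of P. *)
Definition qsub {W : ambient} :
    forall P : subspace W, subspace W -> subspace (quot_ambient P) :=
  match W with
  | SetAmbient T => fun (P U : {set T}) => [set x | val x \in U]
  | VectAmbient F V => fun (P U : {vspace V}) => (linfun (@piv F V P) @: U)%VS
  end.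

Lemma rk_qsub (W : ambient) (P U : subspace W) :
  subsp P U -> (rk (qsub P U) + rk P = rk U)%N.
Proof.
case: W P U => [T|F V] P U /= sPU.
  rewrite -(cardsID P U) (finset.setIidPr sPU) addnC; congr addn.
  rewrite -(card_imset _ val_inj); apply: eq_card => x; rewrite !inE.
  apply/imsetP/andP => [[y + ->]|[xP xU]]; first by rewrite inE (valP y).
  by exists (exist _ x xP); rewrite ?inE.
rewrite -(limg_ker_dim (linfun (@piv F V P)) U) addnC; congr addn.
congr (\dim _); rewrite -{1}(capv_idPr sPU); congr (_ :&: _)%VS.
apply/vspaceP => v; rewrite memv_ker lfunE /= -(linear0 (@piv F V P)).
by rewrite piv_eq subr0.
Qed.

Definition grass (W : ambient) (k : nat) : finType :=
  {U : subspace W | rk U == k}.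

Section Functions.
Variable R : realType.

Definition fn (W : ambient) (k : nat) := {ffun grass W k -> R^o}.

(* f at a subspace not packaged with its rank. The value 0 outside rank k is
   never used below: by [rk_qsub], K / P has rank k.-1 whenever K has rank k and
   contains the point P. *)
Definition value {W k} (f : fn W k) (U : subspace W) : R :=
  if (insub U : option (grass W k)) is Some K then f K else 0.

Definition charfn {W} (k : nat) (U : subspace W) : fn W k :=
  [ffun K : grass W k => (subsp U (val K))%:R].

Definition Vbar (W : ambient) (k i : nat) : {vspace fn W k} :=
  <<[seq charfn k (val J) | J : grass W i]>>%VS.

(* The characteristic functions [charfn k J] with rk J = i are linearly
   independent when i <= min(k, m - k), so there is at most one w as below. *)
Definition wt {W k} (i : nat) (f : fn W k) : fn W i :=
  xget 0 [set w : fn W i |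
    f = \sum_(J : grass W i) w J *: charfn k (val J)]%classic.

Definition deg {W k} (f : fn W k) : \bar int :=
  if f == 0 then -oo%E else
  (nat_of_ord [arg min_(t < ord_max : 'I_(minn k (rk (fullsp W) - k)).+1
                        | f \in Vbar W k t) (t : nat)]%N)%:Z%:E.

Definition Phi {V : ambient} (P : grass V 1) {k : nat}
    (f : fn (quot_ambient (val P)) k.-1) : fn V k :=
  [ffun K : grass V k =>
    if subsp (val P) (val K) then value f (qsub (val P) (val K)) else 0].

End Functions.

(* Main.v *)
(** Write (M_k w)(K) for the sum of w(I) over the subspaces I <= K of rank i,
    with rk K = k. Below a space H, the sum D(M_k w) of M_k w over the covers of
    a subspace of rank k-1 differs from M_(k-1) (D w) only in the coefficient of
    the I contained in that subspace, by [rk H - k + 1]_q - [i]_q: this is the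
    modular law for ranks. Induction on i and k then shows that M_k is injective
    when i <= min(k, rk H - k). It holds in particular on every hyperplane H
    avoiding P: if Phi(f) = sum w(T) x_T with rk T = t < n - k, then Phi(f)
    vanishes on the K <= H, so w(T) = 0 for all T not containing P, and w
    descends to V/P. Hence the degree drops by one in the quotient; the converse
    is Phi(x_I) = x_J for the preimage J of I in V. *)
Require Import Defs.
From HB Require Import structures.
From mathcomp Require Import all_boot all_order all_algebra.
From mathcomp Require Import finfield zify.
From mathcomp Require Import boolp classical_sets reals constructive_ereal.

Set Implicit Arguments.
Unset Strict Implicit.
Unset Printing Implicit Defensive.

Import Order.TTheory GRing.Theory Num.Theory.
Local Open Scope ring_scope.

(** * The lattice of subspaces, uniformly in both cases *)

Definition meetsp {W : ambient} : subspace W -> subspace W -> subspace W :=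
  match W with
  | SetAmbient T => fun A B : {set T} => A :&: B
  | VectAmbient F V => fun A B : {vspace V} => (A :&: B)%VS
  end.

Definition joinsp {W : ambient} : subspace W -> subspace W -> subspace W :=
  match W with
  | SetAmbient T => fun A B : {set T} => A :|: B
  | VectAmbient F V => fun A B : {vspace V} => (A + B)%VS
  end.

Definition botsp (W : ambient) : subspace W :=
  match W with
  | SetAmbient T => finset.set0
  | VectAmbient F V => 0%VS
  end.

(* The q-integer [r]_q, which is the number of points of a space of rank [r]. *)
Definition npoints (W : ambient) (r : nat) : nat :=
  match W with
  | SetAmbient T => r
  | VectAmbient F V => (\sum_(j < r) #|F| ^ j)%N
  end.

Section Lattice.
Variable W : ambient.
Implicit Types A B C I J K : subspace W.

Lemma subsp_refl A : subsp A A.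
Proof. by case: W A => [T|F V] A /=. Qed.

Lemma subsp_trans B A C : subsp A B -> subsp B C -> subsp A C.
Proof.
by case: W A B C => [T|F V] A B C; [exact: fintype.subset_trans|exact: subv_trans].
Qed.

Lemma subsp_meet A B C : subsp A (meetsp B C) = subsp A B && subsp A C.
Proof. by case: W A B C => [T|F V] A B C /=; rewrite ?finset.subsetI ?subv_cap. Qed.

Lemma subsp_join A B C : subsp (joinsp A B) C = subsp A C && subsp B C.
Proof. by case: W A B C => [T|F V] A B C /=; rewrite ?finset.subUset ?subv_add. Qed.

Lemma bot_subsp A : subsp (botsp W) A.
Proof. by case: W A => [T|F V] A /=; rewrite ?finset.sub0set ?sub0v. Qed.

Lemma subsp_full A : subsp A (fullsp W).
Proof. by case: W A => [T|F V] A /=; rewrite ?finset.subsetT ?subvf. Qed.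

Lemma rk_bot : rk (botsp W) = 0%N.
Proof. by case: W => [T|F V] /=; rewrite ?cards0 ?dimv0. Qed.

Lemma rk_modular A B : (rk (joinsp A B) + rk (meetsp A B) = rk A + rk B)%N.
Proof. by case: W A B => [T|F V] A B /=; rewrite ?cardsUI ?dimv_sum_cap. Qed.

Lemma subsp_rk A B : subsp A B -> (rk A <= rk B)%N.
Proof. by case: W A B => [T|F V] A B /=; [exact: subset_leq_card|exact: dimvS]. Qed.

Lemma subsp_eq A B : subsp A B -> (rk B <= rk A)%N -> A = B.
Proof.
case: W A B => [T|F V] A B /= sAB rBA; apply/eqP.
  by rewrite finset.eqEcard sAB.
by rewrite eqEdim sAB.
Qed.

Lemma subsp_meetl A B : subsp (meetsp A B) A.
Proof. by have := subsp_refl (meetsp A B); rewrite subsp_meet => /andP[]. Qed.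

Lemma subsp_meetr A B : subsp (meetsp A B) B.
Proof. by have := subsp_refl (meetsp A B); rewrite subsp_meet => /andP[]. Qed.

Lemma subsp_joinl A B : subsp A (joinsp A B).
Proof. by have := subsp_refl (joinsp A B); rewrite subsp_join => /andP[]. Qed.

Lemma subsp_joinr A B : subsp B (joinsp A B).
Proof. by have := subsp_refl (joinsp A B); rewrite subsp_join => /andP[]. Qed.

Lemma npoints0 : npoints W 0 = 0%N.
Proof. by case: W => //= F V; rewrite big_ord0. Qed.

Lemma npoints1 : npoints W 1 = 1%N.
Proof. by case: W => //= F V; rewrite big_ord_recl big_ord0 expn0 addn0. Qed.

(** Guarantees that the q-integers and differences of q-integers divided by later are non-zero. *)
Lemma ltn_npoints r s : (r < s)%N -> (npoints W r < npoints W s)%N.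
Proof.
case: W => //= F V; elim: s => // s IHs; rewrite ltnS leq_eqVlt big_ord_recr /=.
have Fs : (0 < #|F| ^ s)%N by rewrite expn_gt0 ltnW // finNzRing_gt1.
case/orP => [/eqP-> | /IHs rs]; last exact: leq_trans rs (leq_addr _ _).
by rewrite -[ltnLHS]addn0 ltn_add2l.
Qed.

End Lattice.

(** * Numbers of covers and copoints in an interval *)

Lemma card_vector (F : finFieldType) (V : vectType F) (C : {vspace V}) :
  (#|F| ^ \dim C)%N = #|[pred v : finvect_type V | v \in C]|.
Proof.
case: V C => T cT C; rewrite -(@card_vspace F (finvect_type (Vector.Pack cT)) cT C).
by apply: eq_card => v; rewrite !inE.
Qed.

(** Double count of the pairs of a cover [J] of [I] and a vector [v] of [J] outside [I]: each [J]
    has [q^(i+1) - q^i] such vectors, and each [v] in [K] outside [I] determines [J = I + <[v]>]. *)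
Lemma card_points_vect (F : finFieldType) (V : vectType F) (I K : {vspace V}) :
  (I <= K)%VS ->
  #|[pred J : {vspace V} | [&& (I <= J)%VS, (J <= K)%VS & \dim J == (\dim I).+1]]|
  = (\sum_(j < \dim K - \dim I) #|F| ^ j)%N.
Proof.
move=> sIK; set i : nat := \dim I; set r := (\dim K - i)%N.
set N := #|_|; pose q := #|F|; have q1 : (1 < q)%N := finNzRing_gt1 F.
have leik : (i <= \dim K)%N := dimvS sIK.
pose T := finvect_type V.
have cardD (A B : {vspace V}) : (A <= B)%VS ->
    #|[pred v : T | (v \in B) && (v \notin A)]| = (q ^ \dim B - q ^ \dim A)%N.
  move=> sAB;
  rewrite !card_vector.
  rewrite -(cardID [pred v : T | v \in A] [pred v : T | v \in B]).
  rewrite (_ : #|[predI _ & _]| = #|[pred v : T | v \in A]|); last first.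
    apply: eq_card => v; rewrite !inE andbC; case: (boolP (v \in A)) => //= vA.
    by rewrite (subvP sAB).
  by rewrite addKn; apply: eq_card => v; rewrite !inE andbC.
have dimIv v : v \notin I -> \dim (I + <[v]>) = i.+1.
  move=> vI; rewrite dimv_disjoint_sum.
    by rewrite dim_vline; case: eqP vI => [->|_ _]; rewrite ?mem0v ?addn1.
  apply/eqP; rewrite -subv0; apply/subvP => u; rewrite memv_cap => /andP[uI /vlineP[c uc]].
  rewrite memv0; case: (eqVneq c 0) => [c0|c0]; first by rewrite uc c0 scale0r.
  by case/negP: vI; rewrite -[v]scale1r -(mulVf c0) -scalerA -uc memvZ.
have key : (N * (q ^ i.+1 - q ^ i) = q ^ \dim K - q ^ i)%N.
  rewrite -(cardD _ _ sIK) /N.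
  rewrite -[RHS]sum1_card -sum_nat_const.
  transitivity (\sum_(J : {vspace V} | [&& (I <= J)%VS, (J <= K)%VS & \dim J == i.+1])
                \sum_(v : T | (v \in J) && (v \notin I)) 1)%N.
    apply: eq_bigr => J /and3P[sIJ _ /eqP dJ].
    by rewrite sum1_card cardD // dJ.
  rewrite (exchange_big_dep [pred v : T | (v \in K) && (v \notin I)]) /=; last first.
    by move=> J v /and3P[_ sJK _] /andP[vJ ->]; rewrite (subvP sJK).
  apply: eq_bigr => v /andP[vK vI].
  rewrite (big_pred1 (I + <[v : V]>)%VS) // => J /=; apply/idP/eqP.
    case/andP => /and3P[sIJ sJK /eqP dJ] /andP[vJ _]; apply/eqP; rewrite eq_sym eqEdim.
    rewrite subv_add sIJ -memvE vJ dJ (dimIv v vI). by rewrite leqnn.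
  move=> ->; rewrite addvSl subv_add sIK -memvE vK vI (dimIv v vI) eqxx !andbT /=.
  exact: (subvP (addvSr I <[v : V]>) _ (memv_line _)).
(* Both sides of the count share the factor [q^i (q - 1)]; cancelling it leaves the geometric
   sum. *)
have qi : (0 < q ^ i * q.-1)%N by rewrite muln_gt0 expn_gt0; lia.
apply/eqP; rewrite -(eqn_pmul2l qi) -[X in _ == X]mulnA -(predn_exp q r).
have -> : (q ^ i * q.-1 = q ^ i.+1 - q ^ i)%N by rewrite -subn1 mulnBr muln1 expnSr.
by rewrite mulnC key -subn1 mulnBr muln1 -expnD /r subnKC.
Qed.

Section Counting.
Variable W : ambient.
Implicit Types A B C H I J K : subspace W.

Lemma card_points I K : subsp I K ->
  #|[pred J : subspace W | [&& subsp I J, subsp J K & rk J == (rk I).+1]]|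
  = npoints W (rk K - rk I).
Proof.
case: W I K => [T|F V] I K /= sIK; last exact: card_points_vect.
rewrite (_ : (#|K| - #|I|)%N = #|K :\: I|); last first.
  by rewrite cardsD (finset.setIidPr sIK).
pose h x := x |: I.
have hinj : {in K :\: I &, injective h}.
  move=> x y; rewrite !finset.in_setD => /andP[xI _] _ /finset.setP /(_ x).
  by rewrite !finset.in_setU1 eqxx (negbTE xI) !orbF => /esym /eqP.
rewrite -(card_in_imset hinj); apply: eq_card => J; rewrite !inE.
apply/and3P/imsetP => [[sIJ sJK /eqP cJ]|[x]].
  have /eqP/cards1P[x Jx] : #|J :\: I| = 1%N.
    by rewrite cardsD (finset.setIidPr sIJ) cJ subSnn.
  have : x \in J :\: I by rewrite Jx finset.set11.
  rewrite finset.in_setD => /andP[xI xJ]; exists x.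
    by rewrite finset.in_setD xI (fintype.subsetP sJK).
  by rewrite /h -Jx finset.setUC -{1}(finset.setIidPr sIJ) finset.setID.
rewrite finset.in_setD => /andP[xI xK] ->; rewrite /h finset.subsetUr.
by rewrite finset.subUset finset.sub1set xK sIK cardsU1 xI eqxx.
Qed.

(** Induction on the corank [r] of [I], counting pairs of a cover [J] of [I] inside a copoint [H]:
    each [H] contains [[r-1]_q] such [J], and by induction each [J] lies in [[r-1]_q] such [H]. The
    case [r = 1] is separate because [[0]_q = 0] cannot be cancelled. *)
Lemma card_copoints I K : subsp I K ->
  #|[pred H : subspace W | [&& subsp I H, subsp H K & (rk H).+1 == rk K]]|
  = npoints W (rk K - rk I).
Proof.
move: {2}(rk K - rk I)%N (erefl (rk K - rk I)%N) => r.
elim: r I => [|[|r] IHr] I rE sIK; have := subsp_rk sIK => leIK; rewrite rE.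
- rewrite npoints0; apply: eq_card0 => H; rewrite !inE.
  by apply/negbTE/negP => /and3P[/subsp_rk + _ /eqP]; lia.
- rewrite npoints1 -(card1 I); apply: eq_card => H; rewrite !inE.
  apply/and3P/eqP => [[sIH _ /eqP rH]|->]; last by split; rewrite ?subsp_refl //; lia.
  by apply/esym/subsp_eq => //; lia.
have Npos : (0 < npoints W r.+1)%N by rewrite -(npoints0 W) ltn_npoints.
apply/eqP; rewrite -(eqn_pmul2r Npos); apply/eqP.
transitivity (\sum_(H | [&& subsp I H, subsp H K & (rk H).+1 == rk K])
   \sum_(J | [&& subsp I J, subsp J H & rk J == (rk I).+1]) 1)%N.
  rewrite -sum_nat_const; apply: eq_bigr => H /and3P[sIH _ /eqP rH].
  by rewrite sum1_card card_points //; congr npoints; lia.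
rewrite (exchange_big_dep [pred J | [&& subsp I J, subsp J K & rk J == (rk I).+1]]) /=;
  last first.
  by move=> H J /and3P[_ HK _] /and3P[-> JH ->]; rewrite (subsp_trans JH HK).
rewrite -rE -(card_points sIK) -sum_nat_const; apply: eq_bigr => J /and3P[sIJ sJK /eqP rJ].
rewrite (_ : r.+1 = rk K - rk J)%N; last lia.
rewrite -(IHr J) //; last lia.
rewrite sum1_card; apply: eq_card => H; rewrite !inE -!topredE /= rJ eqxx sIJ andbT /=.
rewrite andbC andbA; case: (boolP (subsp J H)) => //= sJH.
by rewrite (subsp_trans sIJ sJH).
Qed.

End Counting.

(** * Inclusion sums and their injectivity *)

Section Inclusion.
Variables (R : numFieldType) (W : ambient).
Implicit Types (A B C H I J K : subspace W) (w : subspace W -> R).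

(** If [I <= K], the counts become all covers of [K] in [H] and all copoints of [I], which match the
    correction terms crosswise. Otherwise the only candidates are the join and the meet of [K] and
    [I], and by the modular law both have the right rank or neither has. *)
Lemma card_cover_exchange H I K : subsp I H -> subsp K H ->
  (#|[pred J | [&& subsp K J, subsp J H, rk J == (rk K).+1 & subsp I J]]|
     + subsp I K * npoints W (rk I)
   = #|[pred J : subspace W | [&& (rk J).+1 == rk I, subsp J K & subsp J I]]|
     + subsp I K * npoints W (rk H - rk K))%N.
Proof.
move=> sIH sKH; case: (boolP (subsp I K)) => [sIK|nIK]; rewrite ?mul1n.
  rewrite addnC; congr addn.
    rewrite -[rk I in LHS]subn0 -(rk_bot W) -(card_copoints (bot_subsp I)).
    apply: eq_card => J; rewrite -!topredE /= bot_subsp /= andbC; apply: andb_id2l => _.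
    by case: (boolP (subsp J I)) => [/subsp_trans->|]; rewrite ?andbF.
  rewrite -(card_points sKH); apply: eq_card => J; rewrite -!topredE /=.
  by case: (boolP (subsp K J)) => //= sKJ; rewrite (subsp_trans sIK sKJ) andbT.
rewrite !mul0n !addn0.
have rj : (rk K < rk (joinsp K I))%N.
  rewrite ltnNge; apply/negP => /(subsp_eq (subsp_joinl K I)) eKI.
  by rewrite eKI subsp_joinr in nIK.
have rm : (rk (meetsp K I) < rk I)%N.
  rewrite ltnNge; apply/negP => /(subsp_eq (subsp_meetr K I)) eKI.
  by rewrite -eKI subsp_meetl in nIK.
have rkM := rk_modular K I.
have [rI|rI] := eqVneq (rk (meetsp K I)).+1 (rk I).
  transitivity 1%N.
    rewrite -(card1 (joinsp K I)); apply: eq_card => J; rewrite !inE.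
    apply/and4P/eqP => [[sKJ _ /eqP rJ sIJ]|->].
      by apply/esym/subsp_eq; [rewrite subsp_join sKJ|lia].
    by rewrite subsp_joinl subsp_joinr subsp_join sKH sIH; split=> //; apply/eqP; lia.
  rewrite -(card1 (meetsp K I)); apply: eq_card => J; rewrite !inE.
  apply/eqP/and3P => [->|[/eqP rJ sJK sJI]].
    by rewrite subsp_meetl subsp_meetr; split=> //; apply/eqP.
  by apply/subsp_eq; [rewrite subsp_meet sJK|lia].
rewrite !eq_card0 // => J; rewrite !inE; apply/negbTE; apply: contra rI.
  case/and3P => /eqP rJ sJK sJI.
  have /subsp_rk : subsp J (meetsp K I) by rewrite subsp_meet sJK.
  by move=> ?; apply/eqP; lia.
case/and4P => sKJ sJH /eqP rJ sIJ.
have /subsp_rk : subsp (joinsp K I) J by rewrite subsp_join sKJ.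
by move=> ?; apply/eqP; lia.
Qed.

(** The operator [M_k] for [k = rk K]. Taking [w] on all subspaces avoids carrying rank proofs; only
    its values in rank [i] matter. *)
Definition lower_sum (i : nat) w K : R :=
  \sum_(I | (rk I == i) && subsp I K) w I.

(** Moves the condition [I <= K] into the coefficient, so that all sums in the exchange formula run
    over the same [I]. *)
Lemma lower_sum_restrict i w H K : subsp K H ->
  lower_sum i w K = \sum_(I | (rk I == i) && subsp I H) w I *+ subsp I K.
Proof.
move=> sKH; rewrite /lower_sum [RHS](bigID (fun I => subsp I K)) /=.
rewrite [X in _ + X]big1 ?addr0 => [|I /andP[_ /negbTE->] //].
apply: eq_big => [I|I /andP[_ ->] //].
by case: (boolP (subsp I K)) => [/subsp_trans->|]; rewrite ?andbF ?andbT.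
Qed.

Lemma lower_sum_self w K : lower_sum (rk K) w K = w K.
Proof.
rewrite /lower_sum (big_pred1 K) // => I; apply/andP/eqP => [[/eqP rI sIK]|-> //].
  by apply: subsp_eq; rewrite // rI.
by rewrite eqxx subsp_refl.
Qed.

(** Each [w I] is counted once for every copoint of [K] above [I]. *)
Lemma sum_copoints_lower_sum i w K :
  \sum_(J | subsp J K && ((rk J).+1 == rk K)) lower_sum i w J
  = (npoints W (rk K - i))%:R * lower_sum i w K.
Proof.
rewrite /lower_sum (exchange_big_dep [pred I | (rk I == i) && subsp I K]) /=; last first.
  by move=> J I /andP[sJK _] /andP[-> sIJ]; rewrite (subsp_trans sIJ sJK).
rewrite mulr_sumr; apply: eq_bigr => I /andP[/eqP rI sIK].
rewrite sumr_const mulr_natl -rI -(card_copoints sIK); congr (_ *+ _).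
by apply: eq_card => J; rewrite -!topredE /= eqxx andbC andbA.
Qed.

(** After exchanging sums, the coefficients of [w I] are the two sides of [card_cover_exchange]. *)
Lemma sum_points_lower_sum i w H K : subsp K H ->
  \sum_(J | [&& subsp K J, subsp J H & rk J == (rk K).+1]) lower_sum i w J
    + (npoints W i)%:R * lower_sum i w K
  = \sum_(J | ((rk J).+1 == i) && subsp J K)
      \sum_(I | [&& rk I == i, subsp I H & subsp J I]) w I
    + (npoints W (rk H - rk K))%:R * lower_sum i w K.
Proof.
move=> sKH; rewrite (lower_sum_restrict _ _ sKH).
rewrite [X in X + _ = _](_ : _ = \sum_(I | (rk I == i) && subsp I H) w I *+
   #|[pred J | [&& subsp K J, subsp J H, rk J == (rk K).+1 & subsp I J]]|); last first.
  rewrite /lower_sum (exchange_big_dep [pred I | (rk I == i) && subsp I H]) /=; last first.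
    by move=> J I /and3P[_ sJH _] /andP[-> sIJ]; rewrite (subsp_trans sIJ sJH).
  apply: eq_bigr => I /andP[/eqP rI sIH]; rewrite sumr_const; congr (_ *+ _).
  by apply: eq_card => J; rewrite -!topredE /= rI eqxx /= -!andbA.
rewrite [X in _ = X + _](_ : _ = \sum_(I | (rk I == i) && subsp I H) w I *+
   #|[pred J : subspace W | [&& (rk J).+1 == rk I, subsp J K & subsp J I]]|); last first.
  rewrite (exchange_big_dep [pred I | (rk I == i) && subsp I H]) /=; last first.
    by move=> J I _ /and3P[-> ->].
  apply: eq_bigr => I /andP[/eqP rI sIH]; rewrite sumr_const; congr (_ *+ _).
  by apply: eq_card => J; rewrite -!topredE /= rI sIH eqxx /= -!andbA.
rewrite !mulr_sumr -!big_split; apply: eq_bigr => I /andP[/eqP rI sIH] /=.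
by rewrite !mulr_natl -!mulrnA -!mulrnDr -rI card_cover_exchange.
Qed.

(* Since [w] sums to zero in rank [k], [sum_points_lower_sum] in rank [k - 1]
   says that the [lower_sum] of [g J] (the sum of [w] over the covers of [J]) is
   [- c *: lower_sum i w] with [c > 0] because [i + k <= rk H]. Summing this over
   the copoints of a space of rank [k] gives [lower_sum g = 0] in rank [k], so
   [g = 0] by induction on [i], and [w] sums to zero in rank [k - 1]. *)
Lemma lower_sum_inj H i k w :
  (i <= k)%N -> (i + k <= rk H)%N ->
  (forall K, subsp K H -> rk K = k -> lower_sum i w K = 0) ->
  forall I, subsp I H -> rk I = i -> w I = 0.
Proof.
elim/ltn_ind: i k w => i IHi; elim=> [|k IHk] w leik leikH w0 I sIH rI.
  by rewrite -(lower_sum_self w I) rI w0 // rI; lia.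
(* If [k < i], then [i = k + 1], and the hypothesis in that rank is about [w] itself. *)
case: (ltnP k i) => [ltki|{}leik].
  by rewrite -(lower_sum_self w I) rI w0 // rI; lia.
pose g J := \sum_(I | [&& rk I == i, subsp I H & subsp J I]) w I.
have rec K : subsp K H -> rk K = k ->
    \sum_(J | ((rk J).+1 == i) && subsp J K) g J
    = ((npoints W i)%:R - (npoints W (rk H - k))%:R) * lower_sum i w K.
  move=> sKH rK; have := sum_points_lower_sum i w sKH; rewrite big1.
    by rewrite add0r rK mulrBl => ->; rewrite addrK.
  by move=> J /and3P[_ sJH /eqP rJ]; rewrite w0 // rJ rK.
have g0 J : subsp J H -> (rk J).+1 = i -> g J = 0.
  case: i => [//|i] in IHi leikH leik w0 {rI IHk} g rec * => sJH [rJ].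
  apply: (IHi i _ k.+1 g) sJH rJ => //; try lia.
  move=> K sKH rK.
  have nz : (npoints W (k.+1 - i))%:R != 0 :> R.
    by rewrite pnatr_eq0 -lt0n -(npoints0 W) ltn_npoints //; lia.
  apply: (mulfI nz); rewrite mulr0 -{1}rK -sum_copoints_lower_sum.
  transitivity (\sum_(J | subsp J K && ((rk J).+1 == rk K))
      ((npoints W i.+1)%:R - (npoints W (rk H - k))%:R) * lower_sum i.+1 w J).
    apply: eq_bigr => L /andP[sLK /eqP rL]; rewrite -rec //; last lia.
    exact: subsp_trans sLK sKH.
  by rewrite -mulr_sumr sum_copoints_lower_sum w0 ?mulr0.
apply: IHk sIH rI => //; first lia.
move=> K sKH rK; have := rec K sKH rK; rewrite big1 => [/esym/eqP|J /andP[/eqP rJ sJK]].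
  rewrite mulf_eq0 subr_eq0 eqr_nat => /orP[/eqP e|/eqP //].
  have : (npoints W i < npoints W (rk H - k))%N by apply: ltn_npoints; lia.
  by rewrite e ltnn.
by rewrite g0 // (subsp_trans sJK).
Qed.

End Inclusion.

(** * Subspaces of the quotient and their preimages *)

Section Quotient.

(** Inverse of [qsub P] on the subspaces containing [P]; it raises ranks by [rk P]. *)
Definition liftsp {W : ambient} :
    forall P : subspace W, subspace (quot_ambient P) -> subspace W :=
  match W with
  | SetAmbient T => fun (P : {set T}) (I : {set {x : T | x \notin P}}) =>
      P :|: [set val x | x in I]
  | VectAmbient F V => fun (P : {vspace V}) (I : {vspace quotv P}) =>
      (linfun (@piv F V P) @^-1: I)%VS
  end.

Variable W : ambient.
Implicit Types (P J K : subspace W).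

Lemma subsp_liftr P (I : subspace (quot_ambient P)) : subsp P (liftsp I).
Proof.
case: W P I => [T|F V] P I /=; first exact: finset.subsetUl.
apply/subvP => v vP; rewrite -memv_preim lfunE /=.
suff -> : piv P v = 0 by rewrite mem0v.
by apply/eqP; rewrite -(linear0 (@piv F V P)) piv_eq subr0.
Qed.

(** In the linear case, a vector whose class lies in [K / P] differs from one of [K] by an element
    of [P], hence of [K]. *)
Lemma subsp_liftl P (I : subspace (quot_ambient P)) K :
  subsp P K -> subsp (liftsp I) K = subsp I (qsub P K).
Proof.
case: W P I K => [T|F V] P I K /= sPK.
  rewrite finset.subUset sPK /=; apply/fintype.subsetP/fintype.subsetP => [sIK x xI|sIK x].
    by rewrite inE sIK // imset_f.
  by case/imsetP => y yI ->; have := sIK _ yI; rewrite inE.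
apply/subvP/subvP => [sIK x xI|sIK v].
  have [v vx] := piv_surj x; have vI : v \in (linfun (@piv F V P) @^-1: I)%VS.
    by rewrite -memv_preim lfunE /= vx.
  by have := memv_img (linfun (@piv F V P)) (sIK _ vI); rewrite lfunE /= vx.
rewrite -memv_preim => /sIK /memv_imgP[u uK]; rewrite !lfunE /= => /eqP.
by rewrite piv_eq => /(subvP sPK) vuK; rewrite -(subrK u v) memvD.
Qed.

Lemma qsub_lift P (I : subspace (quot_ambient P)) : qsub P (liftsp I) = I.
Proof.
case: W P I => [T|F V] P I /=.
  apply/finset.setP => x; rewrite !inE (negbTE (valP x)) /=.
  by rewrite mem_imset //; exact: val_inj.
apply: lpreimK; apply/subvP => x _; have [v <-] := piv_surj x.
by have := memv_img (linfun (@piv F V P)) (memvf v); rewrite lfunE.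
Qed.

Lemma rk_lift P (I : subspace (quot_ambient P)) : (rk I + rk P = rk (liftsp I))%N.
Proof. by rewrite -(rk_qsub (subsp_liftr I)) qsub_lift. Qed.

Lemma lift_qsub P K : subsp P K -> liftsp (qsub P K) = K.
Proof.
move=> sPK; apply: subsp_eq; first by rewrite subsp_liftl // subsp_refl.
by rewrite -rk_lift rk_qsub.
Qed.

Lemma rk_quot_full P : (rk (fullsp (quot_ambient P)) + rk P = rk (fullsp W))%N.
Proof.
rewrite -(rk_qsub (subsp_full P)); congr (_ + _)%N.
apply/eqP; rewrite eqn_leq [X in _ && X]subsp_rk ?subsp_full // andbT.
rewrite -(leq_add2r (rk P)) rk_lift rk_qsub ?subsp_full //.
by rewrite subsp_rk ?subsp_full.
Qed.

(** For sets, the complement of [P]. For vector spaces, [A] plus a complement of [P + A]: the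
    dimension is [n - 1], and containing [P] would make it everything. *)
Lemma exists_hyperplane P A : rk P = 1%N -> ~~ subsp P A ->
  exists H, [/\ subsp A H, ~~ subsp P H & (rk H).+1 = rk (fullsp W)].
Proof.
case: W P A => [T|F V] P A /= rP nPA.
  exists (~: P); split; last by rewrite cardsT -(cardsC P) rP.
    have /eqP/cards1P[x Px] := rP; move: nPA; rewrite Px finset.sub1set => xA.
    by rewrite finset.subsetC finset.sub1set finset.in_setC.
  have /eqP/cards1P[x ->] := rP.
  by rewrite finset.sub1set finset.in_setC finset.in_set1 eqxx.
have dPA : \dim (P :&: A) = 0%N.
  have : (\dim (P :&: A) < \dim P)%N; last by lia.
  rewrite ltnNge; apply: contra nPA => le; have /eqP <- : (P :&: A)%VS == P.
    by rewrite eqEdim capvSl.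
  exact: capvSr.
have dsum := dimv_sum_cap P A.
pose H := ((P + A)^C + A)%VS.
have dH : \dim H = (\dim {:V} - 1)%N.
  have leV := dimvS (subvf (P + A)%VS).
  rewrite dimv_disjoint_sum ?dimv_compl; first by lia.
  apply/eqP; rewrite -subv0 -(capv_compl (P + A)%VS) capvC capvS ?addvSr //.
have dV : (0 < \dim {:V})%N by have := dimvS (subvf P); rewrite rP.
exists H; split; [exact: addvSr| |by rewrite dH; lia].
apply/negP => sPH; have : (fullv <= H)%VS.
  rewrite -(addv_complf (P + A)%VS) !subv_add sPH addvSr /=; exact: addvSl.
by move/dimvS; lia.
Qed.

(** [liftsp] matches the rank [i] subspaces of [K / P] with the rank [i + 1] subspaces of [K]
    through [P]; the others have weight zero. *)
Lemma lower_sum_qsub (R : numFieldType) P K i (w : subspace W -> R) :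
  rk P = 1%N -> subsp P K ->
  (forall J, rk J = i.+1 -> subsp J K -> ~~ subsp P J -> w J = 0) ->
  lower_sum i (w \o @liftsp W P) (qsub P K) = lower_sum i.+1 w K.
Proof.
move=> rP sPK w0; rewrite /lower_sum.
rewrite [RHS](bigID (fun J => subsp P J)) /= [X in _ + X]big1 ?addr0; last first.
  by move=> J /andP[/andP[/eqP rJ sJK] nPJ]; rewrite w0.
rewrite (reindex_onto (@liftsp W P) (qsub P)) /=; last by move=> J /andP[_ /lift_qsub].
apply: eq_bigl => I; rewrite subsp_liftr subsp_liftl // qsub_lift eqxx !andbT.
by rewrite -rk_lift rP addn1 eqSS.
Qed.

End Quotient.

(** * The chain of spaces [Vbar], degrees and weights *)

Section Degree.
Variable R : realType.

Section Ambient.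
Variable W : ambient.

Lemma fnP k (f g : fn R W k) :
  (forall U, rk U = k -> value f U = value g U) -> f = g.
Proof.
by move=> fg; apply/ffunP => K; have := fg _ (eqP (valP K)); rewrite /value valK.
Qed.

Lemma value0 k U : value (0 : fn R W k) U = 0.
Proof. by rewrite /value; case: insub => // K; rewrite ffunE. Qed.

Lemma value_linear k a (f g : fn R W k) U :
  value (a *: f + g) U = a * value f U + value g U.
Proof.
rewrite /value; case: insub => [K|]; last by rewrite mulr0 addr0.
by rewrite !ffunE.
Qed.

Lemma value_ffun k (w : subspace W -> R) U :
  rk U = k -> value ([ffun K : grass W k => w (val K)] : fn R W k) U = w U.
Proof.
by move/eqP => rU; rewrite /value insubT ffunE.
Qed.

Lemma value_sum_charfn k i (w : fn R W i) U : rk U = k ->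
  value (\sum_(J : grass W i) w J *: charfn R k (val J)) U = lower_sum i (value w) U.
Proof.
move/eqP => rU; rewrite /value insubT sum_ffunE /lower_sum big_mkcondr /=.
rewrite (reindex_omap (val : grass W i -> _) insub) /=; last first.
  by move=> J rJ; rewrite insubT.
apply: eq_big => [J|J _]; first by rewrite valK eqxx (valP J).
rewrite !ffunE /= valK; case: subsp; first by rewrite /GRing.scale /= mulr1.
by rewrite scaler0.
Qed.

Lemma VbarP k i (f : fn R W k) :
  f \in Vbar R W k i <->
  exists w : fn R W i, f = \sum_(J : grass W i) w J *: charfn R k (val J).
Proof.
split=> [|[w ->]]; last first.
  apply: memv_suml => J _; apply/memvZ/memv_span/mapP.
  by exists J; rewrite ?mem_enum.
rewrite /Vbar span_def big_map big_enum /= => /memv_sumP[v vJ ->].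
have c_ J : exists c, v J = c *: charfn R k (val J) by apply/vlineP/vJ.
exists [ffun J => projT1 (cid (c_ J))]; apply: eq_bigr => J _.
by rewrite ffunE; case: cid.
Qed.

(** Passes to weights on all subspaces, the form to which the inclusion sums apply. *)
Lemma Vbar_valueP k i (f : fn R W k) :
  f \in Vbar R W k i <->
  exists w : subspace W -> R, forall U, rk U = k -> value f U = lower_sum i w U.
Proof.
rewrite VbarP; split=> [[w ->]|[w fw]].
  by exists (value w) => U; exact: value_sum_charfn.
exists [ffun J => w (val J)]; apply: fnP => U rU.
rewrite fw // value_sum_charfn //; apply: eq_bigr => J /andP[/eqP rJ _].
by rewrite value_ffun.
Qed.

Lemma Vbar_full k (f : fn R W k) : f \in Vbar R W k k.
Proof. by apply/Vbar_valueP; exists (value f) => U rU; rewrite -[LHS]lower_sum_self rU. Qed.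

(** A [K] of rank [k] above [I] contains [[k - i]_q] covers of [I], so [x_I] is the sum of [x_J]
    over these covers [J], divided by that number. *)
Lemma VbarS k i (f : fn R W k) : (i < k)%N ->
  f \in Vbar R W k i -> f \in Vbar R W k i.+1.
Proof.
move=> ltik /Vbar_valueP[w fw]; apply/Vbar_valueP.
have nz : (npoints W (k - i))%:R != 0 :> R.
  by rewrite pnatr_eq0 -lt0n -(npoints0 W) ltn_npoints //; lia.
exists (fun J => (npoints W (k - i))%:R^-1 * lower_sum i w J) => U rU.
rewrite fw // /lower_sum -mulr_sumr; apply: (mulfI nz).
rewrite mulrA divff // mul1r.
rewrite (exchange_big_dep [pred I | (rk I == i) && subsp I U]) /=; last first.
  by move=> J I /andP[_ sJU] /andP[-> sIJ]; rewrite (subsp_trans sIJ sJU).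
rewrite mulr_sumr; apply: eq_bigr => I /andP[/eqP rI sIU].
rewrite sumr_const mulr_natl -rI -rU -(card_points sIU); congr (_ *+ _).
apply: eq_card => J; rewrite -!topredE /= eqxx /=.
by rewrite andbC -andbA andbCA -andbA.
Qed.

Lemma Vbar_le k i j (f : fn R W k) : (i <= j <= k)%N ->
  f \in Vbar R W k i -> f \in Vbar R W k j.
Proof.
case/andP; elim: j => [|j IHj]; first by rewrite leqn0 => /eqP->.
rewrite leq_eqVlt => /orP[/eqP-> //|leij ltjk fi].
by apply: VbarS => //; apply: IHj => //; lia.
Qed.

(** If [f] is in no [Vbar W k t] with [t <= m], the arg min falls back on [ord_max], that is [m].
    Then [m = n - k], since [Vbar W k k] is the whole space; hence the final disjunction. *)
Lemma deg_spec k (f : fn R W k) (m := minn k (rk (fullsp W) - k)) : f != 0 ->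
  exists d : nat, [/\ deg f = d%:Z%:E, (d <= m)%N,
    forall t, (t <= m)%N -> f \in Vbar R W k t -> (d <= t)%N
    & f \in Vbar R W k d \/ d = (rk (fullsp W) - k)%N].
Proof.
move=> f0; rewrite /deg (negbTE f0); set P := fun t : 'I__ => _.
have [Pm|nPm] := boolP (f \in Vbar R W k m).
  case: arg_minnP => //= d Pd min_d; exists d; split=> //; [by rewrite -ltnS| |by left].
  by move=> t letm; have := min_d (Ordinal (letm : t < m.+1)%N).
exists m; split=> //.
- rewrite /arg_min /extremum; case: pickP => [d /andP[Pd _]|//].
  case/negP: nPm; apply: Vbar_le Pd.
  by rewrite -ltnS ltn_ord geq_minl.
- move=> t letm ft; case/negP: nPm; apply: Vbar_le ft.
  by rewrite letm geq_minl.
- right; rewrite /m; case: (leqP k (rk (fullsp W) - k)) => // lek.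
  by case/negP: nPm; rewrite /m (minn_idPl lek) Vbar_full.
Qed.

Lemma value_wt k i (f : fn R W k) U : f \in Vbar R W k i -> rk U = k ->
  value f U = lower_sum i (value (wt i f)) U.
Proof.
move=> /VbarP ex rU; rewrite -(value_sum_charfn _ rU); congr (value _ U).
exact: (xgetPex 0 ex).
Qed.

(** Uniqueness of weight distributions: injectivity with [H] the whole space, applied to
    [w - w']. *)
Lemma lower_sum_eq k i (w w' : subspace W -> R) :
  (i <= k)%N -> (i + k <= rk (fullsp W))%N ->
  (forall U, rk U = k -> lower_sum i w U = lower_sum i w' U) ->
  forall J, rk J = i -> w J = w' J.
Proof.
move=> leik leikn ww' J rJ; apply/eqP; rewrite -subr_eq0; apply/eqP.
apply: (@lower_sum_inj _ _ (fullsp W) i k (fun I => w I - w' I)) => //; last exact: subsp_full.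
move=> K _ rK; apply/eqP; rewrite /lower_sum big_split /= sumrN subr_eq0.
by apply/eqP; exact: ww'.
Qed.

End Ambient.

(** * Comparison of [f] with [Phi f] *)

Section PointQuotient.
Variables (V : ambient) (P : grass V 1) (k : nat).
Hypothesis k_gt0 : (0 < k)%N.
Let n := rk (fullsp V).
Let Q := quot_ambient (val P).
Implicit Type f : fn R Q k.-1.

Let rP : rk (val P) = 1%N.
Proof. exact/eqP/(valP P). Qed.

Let rk_qsub_point U : subsp (val P) U -> rk U = k -> rk (qsub (val P) U : subspace Q) = k.-1.
Proof. by move=> sPU rU; rewrite -[in RHS]rU -(rk_qsub sPU) rP addn1. Qed.

Let rk_lift_point (I : subspace Q) : rk I = k.-1 -> rk (liftsp I) = k.
Proof. by move=> rI; rewrite -rk_lift rP rI addn1 prednK. Qed.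

Lemma value_Phi f U : rk U = k ->
  value (Phi f) U = if subsp (val P) U then value f (qsub (val P) U) else 0.
Proof. by move/eqP => rU; rewrite {1}/value insubT ffunE. Qed.

Lemma value_lift f (I : subspace Q) : rk I = k.-1 ->
  value f I = value (Phi f) (liftsp I).
Proof.
move=> rI; by rewrite value_Phi ?subsp_liftr ?qsub_lift //; exact: rk_lift_point.
Qed.

(** This is [Phi(x_I) = x_J] in coordinates. If [U] avoids [P], so do all its subspaces, and both
    sides vanish. *)
Lemma Phi_value_sum f i (w : subspace Q -> R) :
  (forall I, rk I = k.-1 -> value f I = lower_sum i w I) ->
  forall U, rk U = k -> value (Phi f) U =
    lower_sum i.+1 (fun J => if subsp (val P) J then w (qsub (val P) J) else 0) U.
Proof.
move=> fw U rU; rewrite value_Phi //; case: ifPn => [sPU|nPU]; last first.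
  rewrite /lower_sum big1 // => J /andP[_ sJU]; case: ifP => // sPJ.
  by rewrite (subsp_trans sPJ sJU) in nPU.
rewrite fw; last exact: rk_qsub_point.
rewrite -(lower_sum_qsub rP sPU) => [|J _ _ /negbTE-> //].
by apply: eq_bigr => I _ /=; rewrite subsp_liftr qsub_lift.
Qed.

Lemma Phi_Vbar f i : f \in Vbar R Q k.-1 i -> Phi f \in Vbar R V k i.+1.
Proof.
by case/Vbar_valueP => w fw; apply/Vbar_valueP; eexists; exact: Phi_value_sum fw.
Qed.

Lemma Phi_Vbar_inv f t : (t <= k)%N -> (t < n - k)%N ->
  Phi f \in Vbar R V k t -> f = 0 \/ exists2 i, t = i.+1 & f \in Vbar R Q k.-1 i.
Proof.
move=> letk lttn /Vbar_valueP[w fw].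
have w0 J : rk J = t -> ~~ subsp (val P) J -> w J = 0.
  (* Every [K <= H] avoids [P], so [Phi f] vanishes there. Injectivity below [H] needs
     [t + k <= n - 1], which is [t < n - k]. *)
  move=> rJ nPJ; have [H [sJH nPH rH]] := exists_hyperplane rP nPJ.
  apply: (@lower_sum_inj _ _ H t k w) => //; first by rewrite -/n in rH; lia.
  move=> K sKH rK; rewrite -fw // value_Phi // ifN //.
  by apply: contra nPH => /subsp_trans->.
(* In rank [0] no subspace contains [P], so all weights vanish and [f = 0]. In rank [i + 1] the
   weights descend along [liftsp]. *)
case: t => [|i] in letk lttn w fw w0 *; [left|right; exists i => //].
  apply: fnP => I rI; rewrite value0 value_lift // fw; last exact: rk_lift_point.
  rewrite /lower_sum big1 // => J /andP[/eqP rJ _]; apply: w0 => //.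
  by apply/negP => /subsp_rk; rewrite rP rJ.
apply/Vbar_valueP; exists (w \o @liftsp _ _) => I rI.
rewrite value_lift // fw; last exact: rk_lift_point.
rewrite -(lower_sum_qsub rP (subsp_liftr I)) ?qsub_lift // => J rJ _; exact: w0.
Qed.

Lemma Phi_eq0 f : (Phi f == 0) = (f == 0).
Proof.
apply/eqP/eqP => [Phi0|->]; apply: fnP => U rU; rewrite value0.
  by rewrite value_lift // Phi0 value0.
by rewrite value_Phi // value0 if_same.
Qed.

Let rk_quot : (rk (fullsp Q) = n.-1)%N.
Proof. by have := rk_quot_full (val P); rewrite rP addn1 /n => <-. Qed.

Lemma deg_Phi f : (k <= n)%N ->
  deg (Phi f) = Order.min (deg f + 1)%E ((n - k)%N%:Z%:E).
Proof.
move=> lekn; have [f0|f0] := eqVneq f 0.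
  have /eqP Phi0 : Phi f == 0 by rewrite Phi_eq0 f0.
  by rewrite Phi0 f0 /deg !eqxx /= minNye.
have Phif0 : Phi f != 0 by rewrite Phi_eq0.
have [d [-> ledm min_d fd]] := deg_spec f0.
have [d' [-> led'm min_d' fd']] := deg_spec Phif0.
rewrite rk_quot in ledm fd min_d; rewrite -/n in led'm fd' min_d'.
(* These three bounds, with [d <= n - k], force [d' = min(d + 1, n - k)]. *)
have le1 : (d' <= n - k)%N by lia.
have le2 : (d < n - k -> d' <= d.+1)%N.
  (* The corank [(n - 1) - (k - 1)] in [V / P] is again [n - k], so [d < n - k] excludes the default
     value of the degree. *)
  move=> ltd; case: fd => [fd|]; [apply: min_d'; [lia|exact: Phi_Vbar]|lia].
have le3 : (d' < n - k -> d < d')%N.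
  move=> ltd; case: fd' => [fd'|]; last lia.
  have [|//||] := Phi_Vbar_inv _ _ fd'; [lia| |].
    by move=> e; rewrite e eqxx in f0.
  by case=> i d'E fi; rewrite d'E ltnS; apply: min_d fi; lia.
rewrite -EFinD -EFin_min; congr (_%:E).
by case: leP; lia.
Qed.

(** The weight carried over by [Phi_value_sum] represents [Phi f] in rank [i + 1], where weights are
    unique. *)
Lemma wt_Phi f i (E : grass V i.+1) :
  (deg f <= i%:Z%:E)%E -> (i.+1 <= minn k (n - k))%N ->
  wt i.+1 (Phi f) E =
    if subsp (val P) (val E) then value (wt i f) (qsub (val P) (val E)) else 0.
Proof.
move=> degi lei.
have fi : f \in Vbar R Q k.-1 i.
  have [->|f0] := eqVneq f 0; first exact: mem0v.
  have [d [degE ledm _ fd]] := deg_spec f0; move: degi; rewrite degE lee_fin => ledi.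
  (* The alternative [d = n - k] contradicts [d <= i < n - k]. *)
  rewrite rk_quot in fd; case: fd => [fd|]; last by lia.
  by apply: Vbar_le fd; lia.
have -> : wt i.+1 (Phi f) E = value (wt i.+1 (Phi f)) (val E) by rewrite /value valK.
apply: (@lower_sum_eq V k i.+1 _ (fun J =>
  if subsp (val P) J then value (wt i f) (qsub (val P) J) else 0)).
- by lia.
- by rewrite -/n; lia.
- move=> U rU; rewrite -value_wt //; last exact: Phi_Vbar.
  by apply: Phi_value_sum => // I rI; exact: value_wt.
- exact/eqP/(valP E).
Qed.

End PointQuotient.

End Degree.

(** * The five properties of [Phi] *)

Theorem theorem6p3 (R : realType) (V : ambient) (P : grass V 1) (k : nat)
    (n := rk (fullsp V)) (Phi := @Phi R V P k) :
  (1 <= n)%N -> (1 <= k <= n)%N ->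
  [/\ linear Phi,
      injective Phi,
      range Phi =
        [set g : fn R V k | forall K : grass V k, g K != 0 -> subsp (val P) (val K)]%classic,
      forall f, deg (Phi f) = Order.min (deg f + 1)%E ((n - k)%N%:Z%:E)
    & forall f (e : nat),
        (Order.max (deg f) 0 + 1 <= e%:Z%:E)%E -> (e <= minn k (n - k))%N ->
        forall E : grass V e,
          wt e (Phi f) E =
          if subsp (val P) (val E)
          then value (wt e.-1 f) (qsub (val P) (val E)) else 0].
Proof.
move=> _ /andP[k_gt0 lekn]; split.
- move=> a f g; apply: fnP => U rU; rewrite value_linear !value_Phi // value_linear.
  by case: ifP => _; rewrite ?mulr0 ?addr0.
- move=> f g fg; apply: fnP => I rI; rewrite !value_lift //.
  by congr (value _ _).
- apply/seteqP; split=> [_ [f _ <-] K|g gP] /=.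
    by rewrite ffunE; case: ifP => // _; rewrite eqxx.
  (* The preimage of [g] evaluates [g] at lifted subspaces; off the [K] through [P] both sides
     vanish by the support condition. *)
  exists [ffun I => value g (liftsp (val I))] => //.
  apply: fnP => U rU; rewrite value_Phi //; case: ifPn => [sPU|nPU].
    rewrite (value_ffun (fun I => value g (liftsp I))) ?lift_qsub //.
    have := rk_qsub sPU; rewrite rU (eqP (valP P)) => <-.
    by rewrite addn1.
  move/eqP: (rU) => rU'; rewrite /value insubT; apply/esym/eqP; apply: contraNT nPU.
  exact: gP.
- by move=> f; exact: deg_Phi.
move=> f [|e] dege lee E.
  (* Rank [e = 0] is excluded because [max(deg f, 0) + 1] is at least [1]. *)
  have : (1 <= 0 :> \bar int)%E; last by rewrite lee_fin.
  apply: le_trans dege; rewrite -[leLHS]add0e leeD2r //; by rewrite le_max lexx orbT.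
apply: wt_Phi => //; apply: (@le_trans _ _ (Order.max (deg f) 0)).
  by rewrite le_max lexx.
by move: dege; rewrite intS [in leRHS]addrC EFinD leeD2rE.
Qed.
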